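(* Let $\mathcal{B},\mathcal{C},\mathcal{D}$ be bicategories. A strong 2-functor $F\colon\mathcal{B}\to\mathcal{C}$, with structure isomorphisms $\phi\colon F(M)\odot F(N)\to F(M\odot N)$, induces a strong 2-functor $\Lambda F\colon\Lambda\mathcal{B}\to\Lambda\mathcal{C}$ given (i) on 0-cells by $\Lambda F(P)=F(P)$; (ii) on 1-cells $(M,\psi)\colon P\to Q$ by $\Lambda F(M,\psi)=\bigl(F(M),\ F(P)\odot F(M)\xrightarrow{\phi}F(P\odot M)\xrightarrow{F(\psi)}F(M\odot Q)\xrightarrow{\phi^{-1}}F(M)\odot F(Q)\bigr)$; (iii) on 2-cells by $\Lambda F(\beta)=F(\beta)$. Moreover, if $F\colon\mathcal{B}\to\mathcal{C}$ and $G\colon\mathcal{C}\to\mathcal{D}$ are strong 2-functors, then $\Lambda(G\circ F)=(\Lambda G)\circ(\Lambda F)$.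
   Context: Composition of 1-cells in a bicategory is written diagrammatically: $M\colon A\to B$ and $N\colon B\to C$ give $M\odot N\colon A\to C$; unit 1-cells are $U_A$; the left and right unitors are $\ell,r$. A strong 2-functor is a pseudofunctor (invertible structure 2-cells). A 1-cell $M\colon A\to B$ is (right) dualizable if there is a 1-cell $M^*\colon B\to A$ and 2-cells $\eta\colon U_A\to M\odot M^*$, $\epsilon\colon M^*\odot M\to U_B$ satisfying the triangle identities. For a bicategory $\mathcal{B}$, $\Lambda\mathcal{B}$ is the bicategory whose 0-cells are the endomorphism 1-cells of $\mathcal{B}$; whose 1-cells from $P\colon V\to V$ to $Q\colon W\to W$ are pairs $(M,\psi)$ with $M\colon V\to W$ dualizable and $\psi\colon P\odot M\Rightarrow M\odot Q$ a 2-cell; and whose 2-cells $(M,\psi)\Rightarrow(M',\psi')$ are isomorphism 2-cells $\beta\colon M\Rightarrow M'$ with $\psi'\circ(\mathrm{id}_P\odot\beta)=(\beta\odot\mathrm{id}_Q)\circ\psi$. Vertical composition, associators and unitors are those of $\mathcal{B}$. The composite of $(M,\beta)\colon P\to Q$ and $(N,\gamma)\colon Q\to T$ is $M\odot N$ with the 2-cell (suppressing associators) $P\odot M\odot N\xrightarrow{\beta\odot\mathrm{id}_N}M\odot Q\odot N\xrightarrow{\mathrm{id}_M\odot\gamma}M\odot N\odot T$. The unit at $P\colon V\to V$ is $U_V$ with $P\odot U_V\xrightarrow{r}P\xrightarrow{\ell^{-1}}U_V\odot P$. *)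

(* Defs.v *)
From Corelib Require Import ssreflect.
From Stdlib Require Import ProofIrrelevance.

Set Implicit Arguments.
Unset Strict Implicit.
Unset Printing Implicit Defensive.

Declare Scope bicat_scope.
Delimit Scope bicat_scope with bicat.
Local Open Scope bicat_scope.

Reserved Notation "g ∘ f" (at level 40, left associativity).
Reserved Notation "M ⊙ N" (at level 39, left associativity).
Reserved Notation "a ⊙₂ b" (at level 39, left associativity).

(** Horizontal composition is diagrammatic ([M ⊙ N] for [M : A -> B] and
    [N : B -> C]), vertical composition is applicative ([g ∘ f] is [g] after
    [f]).  [cell M N] is the type of 2-cells [M => N]. *)

Record Bicategory := {
  ob :> Type;
  hom : ob -> ob -> Type;
  cell : forall A B, hom A B -> hom A B -> Type;

  id2 : forall A B (M : hom A B), cell M M;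
  vcomp : forall A B (M N P : hom A B), cell N P -> cell M N -> cell M P
    where "g ∘ f" := (vcomp g f);

  unit1 : forall A, hom A A;
  hcomp : forall A B C, hom A B -> hom B C -> hom A C
    where "M ⊙ N" := (hcomp M N);
  hcomp2 : forall A B C (M M' : hom A B) (N N' : hom B C),
    cell M M' -> cell N N' -> cell (M ⊙ N) (M' ⊙ N')
    where "a ⊙₂ b" := (hcomp2 a b);

  assoc : forall A B C D (M : hom A B) (N : hom B C) (P : hom C D),
    cell ((M ⊙ N) ⊙ P) (M ⊙ (N ⊙ P));
  assoc_inv : forall A B C D (M : hom A B) (N : hom B C) (P : hom C D),
    cell (M ⊙ (N ⊙ P)) ((M ⊙ N) ⊙ P);
  lun : forall A B (M : hom A B), cell (unit1 A ⊙ M) M;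
  lun_inv : forall A B (M : hom A B), cell M (unit1 A ⊙ M);
  run : forall A B (M : hom A B), cell (M ⊙ unit1 B) M;
  run_inv : forall A B (M : hom A B), cell M (M ⊙ unit1 B);

  vcompA : forall A B (M N P Q : hom A B)
    (h : cell P Q) (g : cell N P) (f : cell M N), (h ∘ g) ∘ f = h ∘ (g ∘ f);
  vcomp1l : forall A B (M N : hom A B) (f : cell M N), id2 N ∘ f = f;
  vcomp1r : forall A B (M N : hom A B) (f : cell M N), f ∘ id2 M = f;

  hcomp2_id : forall A B C (M : hom A B) (N : hom B C),
    id2 M ⊙₂ id2 N = id2 (M ⊙ N);
  hcomp2_vcomp : forall A B C (M M' M'' : hom A B) (N N' N'' : hom B C)
    (a' : cell M' M'') (a : cell M M') (b' : cell N' N'') (b : cell N N'),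
    (a' ∘ a) ⊙₂ (b' ∘ b) = (a' ⊙₂ b') ∘ (a ⊙₂ b);

  assoc_nat : forall A B C D
    (M M' : hom A B) (N N' : hom B C) (P P' : hom C D)
    (a : cell M M') (b : cell N N') (c : cell P P'),
    assoc M' N' P' ∘ ((a ⊙₂ b) ⊙₂ c) = (a ⊙₂ (b ⊙₂ c)) ∘ assoc M N P;
  lun_nat : forall A B (M M' : hom A B) (a : cell M M'),
    lun M' ∘ (id2 (unit1 A) ⊙₂ a) = a ∘ lun M;
  run_nat : forall A B (M M' : hom A B) (a : cell M M'),
    run M' ∘ (a ⊙₂ id2 (unit1 B)) = a ∘ run M;

  assocK : forall A B C D (M : hom A B) (N : hom B C) (P : hom C D),
    assoc_inv M N P ∘ assoc M N P = id2 _;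
  assocVK : forall A B C D (M : hom A B) (N : hom B C) (P : hom C D),
    assoc M N P ∘ assoc_inv M N P = id2 _;
  lunK : forall A B (M : hom A B), lun_inv M ∘ lun M = id2 _;
  lunVK : forall A B (M : hom A B), lun M ∘ lun_inv M = id2 _;
  runK : forall A B (M : hom A B), run_inv M ∘ run M = id2 _;
  runVK : forall A B (M : hom A B), run M ∘ run_inv M = id2 _;

  pentagon : forall A B C D E
    (M : hom A B) (N : hom B C) (P : hom C D) (Q : hom D E),
    assoc M N (P ⊙ Q) ∘ assoc (M ⊙ N) P Q
    = (id2 M ⊙₂ assoc N P Q) ∘ assoc M (N ⊙ P) Q ∘ (assoc M N P ⊙₂ id2 Q);
  triangle : forall A B C (M : hom A B) (N : hom B C),
    (id2 M ⊙₂ lun N) ∘ assoc M (unit1 B) N = run M ⊙₂ id2 N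
}.

Arguments unit1 {_} A.

Notation "g ∘ f" := (vcomp g f) : bicat_scope.
Notation "M ⊙ N" := (hcomp M N) : bicat_scope.
Notation "a ⊙₂ b" := (hcomp2 a b) : bicat_scope.

Definition is_iso (B : Bicategory) (A A' : B) (M N : hom A A') (f : cell M N)
  : Prop :=
  exists g : cell N M, g ∘ f = id2 M /\ f ∘ g = id2 N.

Definition is_right_dual (B : Bicategory) (A A' : B)
  (M : hom A A') (Mstar : hom A' A)
  (eta : cell (unit1 A) (M ⊙ Mstar)) (eps : cell (Mstar ⊙ M) (unit1 A'))
  : Prop :=
  run M ∘ (id2 M ⊙₂ eps) ∘ assoc M Mstar M ∘ (eta ⊙₂ id2 M) ∘ lun_inv M
    = id2 M
  /\
  lun Mstar ∘ (eps ⊙₂ id2 Mstar) ∘ assoc_inv Mstar M Mstar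
    ∘ (id2 Mstar ⊙₂ eta) ∘ run_inv Mstar
    = id2 Mstar.

Definition right_dualizable (B : Bicategory) (A A' : B) (M : hom A A') : Prop :=
  exists (Mstar : hom A' A) (eta : cell (unit1 A) (M ⊙ Mstar))
    (eps : cell (Mstar ⊙ M) (unit1 A')), is_right_dual eta eps.

Section Coherence.

Lemma reassoc (B : Bicategory) (X Y : B) (M N P : hom X Y) (f : cell N P)
  (g : cell M N) (h : cell M P) :
  f ∘ g = h -> forall L (x : cell L M), f ∘ (g ∘ x) = h ∘ x.
Proof. by move=> <- L x; rewrite vcompA. Qed.

Lemma reassoc2 (B : Bicategory) (X Y : B) (M N N' P : hom X Y) (f : cell N P)
  (g : cell M N) (f' : cell N' P) (g' : cell M N') :
  f ∘ g = f' ∘ g' -> forall L (x : cell L M), f ∘ (g ∘ x) = f' ∘ (g' ∘ x).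
Proof. by move=> e L x; rewrite -!vcompA e. Qed.

Lemma cancel_id (B : Bicategory) (X Y : B) (M N : hom X Y) (f : cell N M)
  (g : cell M N) :
  f ∘ g = id2 M -> forall L (x : cell L M), f ∘ (g ∘ x) = x.
Proof. by move=> e L x; rewrite -vcompA e vcomp1l. Qed.

Lemma iso_mono (B : Bicategory) (X Y : B) (L M N : hom X Y) (i : cell M N)
  (j : cell N M) (f g : cell L M) :
  j ∘ i = id2 M -> i ∘ f = i ∘ g -> f = g.
Proof.
by move=> ji e; rewrite -(vcomp1l f) -(vcomp1l g) -ji !vcompA e.
Qed.

Lemma iso_epi (B : Bicategory) (X Y : B) (L M N : hom X Y) (i : cell L M)
  (j : cell M L) (f g : cell M N) :
  i ∘ j = id2 M -> f ∘ i = g ∘ i -> f = g.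
Proof.
by move=> ij e; rewrite -(vcomp1r f) -(vcomp1r g) -ij -!vcompA e.
Qed.

Lemma conj_inv (B : Bicategory) (X Y : B) (M N M' N' : hom X Y)
  (a : cell M M') (a' : cell M' M) (b : cell N N') (b' : cell N' N)
  (f : cell M N) (g : cell M' N') :
  a ∘ a' = id2 M' -> b' ∘ b = id2 N ->
  b ∘ f = g ∘ a -> f ∘ a' = b' ∘ g.
Proof.
move=> aa bb e; rewrite -[f]vcomp1l -bb !vcompA; congr (_ ∘ _).
by rewrite -vcompA e vcompA aa vcomp1r.
Qed.

Variable B : Bicategory.

Lemma hcomp2_id1 (X Y Z : B) (M : hom X Y) (N N' N'' : hom Y Z)
  (g : cell N' N'') (f : cell N N') :
  id2 M ⊙₂ (g ∘ f) = (id2 M ⊙₂ g) ∘ (id2 M ⊙₂ f).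
Proof. by rewrite -hcomp2_vcomp vcomp1l. Qed.

Lemma hcomp2_1id (X Y Z : B) (M M' M'' : hom X Y) (N : hom Y Z)
  (g : cell M' M'') (f : cell M M') :
  (g ∘ f) ⊙₂ id2 N = (g ⊙₂ id2 N) ∘ (f ⊙₂ id2 N).
Proof. by rewrite -hcomp2_vcomp vcomp1l. Qed.

Lemma hcomp2_lr (X Y Z : B) (M M' : hom X Y) (N N' : hom Y Z)
  (f : cell M M') (g : cell N N') :
  (f ⊙₂ id2 N') ∘ (id2 M ⊙₂ g) = f ⊙₂ g.
Proof. by rewrite -hcomp2_vcomp vcomp1l vcomp1r. Qed.

Lemma hcomp2_rl (X Y Z : B) (M M' : hom X Y) (N N' : hom Y Z)
  (f : cell M M') (g : cell N N') :
  (id2 M' ⊙₂ g) ∘ (f ⊙₂ id2 N) = f ⊙₂ g.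
Proof. by rewrite -hcomp2_vcomp vcomp1l vcomp1r. Qed.

Lemma hcomp2_swap (X Y Z : B) (M M' : hom X Y) (N N' : hom Y Z)
  (f : cell M M') (g : cell N N') :
  (f ⊙₂ id2 N') ∘ (id2 M ⊙₂ g) = (id2 M' ⊙₂ g) ∘ (f ⊙₂ id2 N).
Proof. by rewrite hcomp2_lr hcomp2_rl. Qed.

Lemma hcomp2_idK (X Y Z : B) (M : hom X Y) (N N' : hom Y Z)
  (g : cell N' N) (f : cell N N') :
  g ∘ f = id2 N -> (id2 M ⊙₂ g) ∘ (id2 M ⊙₂ f) = id2 (M ⊙ N).
Proof. by move=> e; rewrite -hcomp2_id1 e hcomp2_id. Qed.

Lemma hcomp2_Kid (X Y Z : B) (M M' : hom X Y) (N : hom Y Z)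
  (g : cell M' M) (f : cell M M') :
  g ∘ f = id2 M -> (g ⊙₂ id2 N) ∘ (f ⊙₂ id2 N) = id2 (M ⊙ N).
Proof. by move=> e; rewrite -hcomp2_1id e hcomp2_id. Qed.

Lemma assoc_inv_nat (X Y Z W : B)
  (M M' : hom X Y) (N N' : hom Y Z) (P P' : hom Z W)
  (a : cell M M') (b : cell N N') (c : cell P P') :
  ((a ⊙₂ b) ⊙₂ c) ∘ assoc_inv M N P = assoc_inv M' N' P' ∘ (a ⊙₂ (b ⊙₂ c)).
Proof. by apply: (conj_inv (assocVK _ _ _) (assocK _ _ _)); rewrite assoc_nat. Qed.

Lemma lun_inv_nat (X Y : B) (M M' : hom X Y) (a : cell M M') :
  (id2 (unit1 X) ⊙₂ a) ∘ lun_inv M = lun_inv M' ∘ a.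
Proof. by apply: (conj_inv (lunVK _) (lunK _)); rewrite lun_nat. Qed.

Lemma run_inv_nat (X Y : B) (M M' : hom X Y) (a : cell M M') :
  (a ⊙₂ id2 (unit1 Y)) ∘ run_inv M = run_inv M' ∘ a.
Proof. by apply: (conj_inv (runVK _) (runK _)); rewrite run_nat. Qed.

Lemma pentagon_inv (X Y Z W V : B)
  (M : hom X Y) (N : hom Y Z) (P : hom Z W) (Q : hom W V) :
  assoc_inv (M ⊙ N) P Q ∘ assoc_inv M N (P ⊙ Q)
  = (assoc_inv M N P ⊙₂ id2 Q)
    ∘ (assoc_inv M (N ⊙ P) Q ∘ (id2 M ⊙₂ assoc_inv N P Q)).
Proof.
set f := (X in X = _); set g := (X in _ = X).
pose h := assoc M N (P ⊙ Q) ∘ assoc (M ⊙ N) P Q.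
have hf : h ∘ f = id2 _.
  by rewrite /h /f vcompA (cancel_id (assocVK _ _ _)) assocVK.
have fh : f ∘ h = id2 _.
  by rewrite /h /f vcompA (cancel_id (assocK _ _ _)) assocK.
apply: (iso_mono fh); rewrite hf /h /g pentagon !vcompA.
rewrite (cancel_id (hcomp2_Kid _ (assocVK _ _ _))).
by rewrite (cancel_id (assocVK _ _ _)) (hcomp2_idK _ (assocVK _ _ _)).
Qed.

Lemma triangle_inv (X Y Z : B) (M : hom X Y) (N : hom Y Z) :
  (run M ⊙₂ id2 N) ∘ assoc_inv M (unit1 Y) N = id2 M ⊙₂ lun N.
Proof. by rewrite -triangle vcompA assocVK vcomp1r. Qed.

Lemma unit_left_faithful (X Y : B) (M N : hom X Y) (f g : cell M N) :
  id2 (unit1 X) ⊙₂ f = id2 (unit1 X) ⊙₂ g -> f = g.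
Proof.
move=> e; apply: (iso_epi (lunVK M)); by rewrite -!lun_nat e.
Qed.

Lemma unit_right_faithful (X Y : B) (M N : hom X Y) (f g : cell M N) :
  f ⊙₂ id2 (unit1 Y) = g ⊙₂ id2 (unit1 Y) -> f = g.
Proof.
move=> e; apply: (iso_epi (runVK M)); by rewrite -!run_nat e.
Qed.

Lemma lun_hcomp (X Y Z : B) (M : hom X Y) (N : hom Y Z) :
  lun (M ⊙ N) ∘ assoc (unit1 X) M N = lun M ⊙₂ id2 N.
Proof.
apply: unit_left_faithful; rewrite hcomp2_id1.
apply: (iso_epi (assocVK _ _ _)).
apply: (iso_epi (hcomp2_Kid _ (assocVK _ _ _))).
rewrite !vcompA -[assoc _ _ _ ∘ _ in RHS]vcomp1l.
rewrite -[(id2 _ ⊙₂ assoc _ _ _) ∘ _]vcompA -pentagon.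
rewrite -vcompA triangle -(hcomp2_id M N) -assoc_nat -triangle hcomp2_1id.
by rewrite vcomp1l -!vcompA assoc_nat.
Qed.

End Coherence.

(** The bicategory with reversed 1-cells; only used to dualize coherence
    arguments. *)
Definition op (B : Bicategory) : Bicategory.
Proof.
refine {|
  ob := ob B; hom := fun X Y => @hom B Y X;
  cell := fun X Y M N => @cell B Y X M N;
  id2 := fun X Y M => id2 M;
  vcomp := fun X Y M N P g f => g ∘ f;
  unit1 := fun X => unit1 X;
  hcomp := fun X Y Z M N => N ⊙ M;
  hcomp2 := fun X Y Z M M' N N' a b => b ⊙₂ a;
  assoc := fun X Y Z W M N P => assoc_inv P N M;
  assoc_inv := fun X Y Z W M N P => assoc P N M;
  lun := fun X Y M => run M; lun_inv := fun X Y M => run_inv M;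
  run := fun X Y M => lun M; run_inv := fun X Y M => lun_inv M
|}; intros.
- exact: vcompA.
- exact: vcomp1l.
- exact: vcomp1r.
- exact: hcomp2_id.
- exact: hcomp2_vcomp.
- by rewrite assoc_inv_nat.
- exact: run_nat.
- exact: lun_nat.
- exact: assocVK.
- exact: assocK.
- exact: runK.
- exact: runVK.
- exact: lunK.
- exact: lunVK.
- by rewrite pentagon_inv !vcompA.
- exact: triangle_inv.
Defined.

Section Coherence2.
Variable B : Bicategory.

Lemma run_hcomp (X Y Z : B) (M : hom X Y) (N : hom Y Z) :
  run (M ⊙ N) ∘ assoc_inv M N (unit1 Z) = id2 M ⊙₂ run N.
Proof. exact: (@lun_hcomp (op B) Z Y X N M). Qed.

Lemma lun_unit (X : B) : lun (unit1 X) = run (unit1 X).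
Proof.
apply: unit_right_faithful; rewrite -lun_hcomp -triangle.
congr (_ ∘ _); apply: (iso_mono (lunK _)); by rewrite lun_nat.
Qed.

End Coherence2.

Section Duals.

Definition triangle1 (B : Bicategory) (A A' : B)
  (M : hom A A') (Mstar : hom A' A)
  (eta : cell (unit1 A) (M ⊙ Mstar)) (eps : cell (Mstar ⊙ M) (unit1 A')) :=
  run M ∘ (id2 M ⊙₂ eps) ∘ assoc M Mstar M ∘ (eta ⊙₂ id2 M) ∘ lun_inv M
    = id2 M.

Definition epsw (B : Bicategory) (A A' Z : B) (M : hom A A') (Ms : hom A' A)
  (eps : cell (Ms ⊙ M) (unit1 A')) (Y : hom Z A') : cell ((Y ⊙ Ms) ⊙ M) Y :=
  run Y ∘ ((id2 Y ⊙₂ eps) ∘ assoc Y Ms M).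

Definition etaw (B : Bicategory) (A A' Z : B) (M : hom A A') (Ms : hom A' A)
  (eta : cell (unit1 A) (M ⊙ Ms)) (X : hom Z A) : cell X ((X ⊙ M) ⊙ Ms) :=
  assoc_inv X M Ms ∘ ((id2 X ⊙₂ eta) ∘ run_inv X).

Lemma epsw_nat (B : Bicategory) (A A' Z : B) (M : hom A A') (Ms : hom A' A)
  (eps : cell (Ms ⊙ M) (unit1 A')) (Y Y' : hom Z A') (f : cell Y Y') :
  epsw eps Y' ∘ ((f ⊙₂ id2 Ms) ⊙₂ id2 M) = f ∘ epsw eps Y.
Proof.
rewrite /epsw !vcompA assoc_nat hcomp2_id.
rewrite -(reassoc2 (hcomp2_swap _ _)).
by rewrite (reassoc2 (run_nat _)).
Qed.

Lemma epsw_hcomp (B : Bicategory) (A A' Z W : B) (M : hom A A')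
  (Ms : hom A' A) (eps : cell (Ms ⊙ M) (unit1 A'))
  (X : hom W Z) (Y : hom Z A') :
  epsw eps (X ⊙ Y)
  = (id2 X ⊙₂ epsw eps Y) ∘ (assoc X (Y ⊙ Ms) M ∘ (assoc X Y Ms ⊙₂ id2 M)).
Proof.
rewrite /epsw 2!hcomp2_id1 !vcompA.
have -> : run (X ⊙ Y) = (id2 X ⊙₂ run Y) ∘ assoc _ _ _.
  by rewrite -run_hcomp vcompA assocK vcomp1r.
rewrite !vcompA; congr (_ ∘ _).
rewrite -hcomp2_id (reassoc2 (assoc_nat _ _ _)); congr (_ ∘ _).
by rewrite pentagon !vcompA.
Qed.

Lemma run_inv_triangle (B : Bicategory) (X Y Z : B) (M : hom X Y)
  (N : hom Y Z) :
  assoc M (unit1 Y) N ∘ (run_inv M ⊙₂ id2 N) = id2 M ⊙₂ lun_inv N.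
Proof.
apply: (iso_mono (hcomp2_idK _ (lunK _))).
by rewrite -vcompA triangle (hcomp2_Kid _ (runVK _)) (hcomp2_idK _ (lunVK _)).
Qed.

Lemma lun_inv_hcomp (B : Bicategory) (X Y Z : B) (M : hom X Y)
  (N : hom Y Z) :
  assoc_inv (unit1 X) M N ∘ lun_inv (M ⊙ N) = lun_inv M ⊙₂ id2 N.
Proof.
apply: (iso_mono (hcomp2_Kid _ (lunK _))).
rewrite (hcomp2_Kid _ (lunVK _)) -lun_hcomp !vcompA.
by rewrite (cancel_id (assocVK _ _ _)) lunVK.
Qed.

Lemma triangle1w (B : Bicategory) (A A' Z : B) (M : hom A A') (Ms : hom A' A)
  (eta : cell (unit1 A) (M ⊙ Ms)) (eps : cell (Ms ⊙ M) (unit1 A'))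
  (X : hom Z A) :
  triangle1 eta eps ->
  epsw eps (X ⊙ M) ∘ (etaw eta X ⊙₂ id2 M) = id2 (X ⊙ M).
Proof.
move=> t; rewrite epsw_hcomp /etaw !hcomp2_1id !vcompA.
rewrite (cancel_id (hcomp2_Kid _ (assocVK _ _ _))).
rewrite (reassoc2 (assoc_nat _ _ _)) run_inv_triangle -!hcomp2_id1.
rewrite -hcomp2_id; congr (_ ⊙₂ _).
by rewrite -[RHS]t /epsw !vcompA.
Qed.

Definition etaK (B : Bicategory) (A1 A2 A3 : B) (M : hom A1 A2)
  (N : hom A2 A3) (Ms : hom A2 A1) (Ns : hom A3 A2)
  (eta : cell (unit1 A1) (M ⊙ Ms)) (eta' : cell (unit1 A2) (N ⊙ Ns)) :
  cell (unit1 A1) ((M ⊙ N) ⊙ (Ns ⊙ Ms)) :=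
  assoc (M ⊙ N) Ns Ms ∘ ((etaw eta' M ⊙₂ id2 Ms) ∘ eta).

Definition epsK (B : Bicategory) (A1 A2 A3 : B) (M : hom A1 A2)
  (N : hom A2 A3) (Ms : hom A2 A1) (Ns : hom A3 A2)
  (eps : cell (Ms ⊙ M) (unit1 A2)) (eps' : cell (Ns ⊙ N) (unit1 A3)) :
  cell ((Ns ⊙ Ms) ⊙ (M ⊙ N)) (unit1 A3) :=
  eps' ∘ ((epsw eps Ns ⊙₂ id2 N) ∘ assoc_inv (Ns ⊙ Ms) M N).

Lemma epswK (B : Bicategory) (A1 A2 A3 Z : B) (M : hom A1 A2)
  (N : hom A2 A3) (Ms : hom A2 A1) (Ns : hom A3 A2)
  (eps : cell (Ms ⊙ M) (unit1 A2)) (eps' : cell (Ns ⊙ N) (unit1 A3))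
  (K : hom Z A3) :
  epsw (epsK eps eps') K ∘ (assoc K Ns Ms ⊙₂ id2 (M ⊙ N))
  = epsw eps' K ∘ ((epsw eps (K ⊙ Ns) ⊙₂ id2 N) ∘ assoc_inv _ M N).
Proof.
rewrite /epsK (epsw_hcomp eps); move: (epsw eps Ns) => e.
rewrite /epsw !hcomp2_id1 !hcomp2_1id !vcompA; congr (_ ∘ (_ ∘ _)).
rewrite (reassoc2 (assoc_nat _ _ _)); congr (_ ∘ _).
apply: (iso_mono (hcomp2_idK _ (assocK _ _ _))).
rewrite (cancel_id (hcomp2_idK _ (assocVK _ _ _))).
rewrite assoc_inv_nat hcomp2_id -!vcompA -pentagon !vcompA.
by rewrite (cancel_id (assocVK _ _ _)).
Qed.

Lemma triangle1K (B : Bicategory) (A1 A2 A3 : B) (M : hom A1 A2)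
  (N : hom A2 A3) (Ms : hom A2 A1) (Ns : hom A3 A2)
  (eta : cell (unit1 A1) (M ⊙ Ms)) (eta' : cell (unit1 A2) (N ⊙ Ns))
  (eps : cell (Ms ⊙ M) (unit1 A2)) (eps' : cell (Ns ⊙ N) (unit1 A3)) :
  triangle1 eta eps -> triangle1 eta' eps' ->
  triangle1 (etaK eta eta') (epsK eps eps').
Proof.
move=> t t'; rewrite /triangle1 !vcompA.
have E : forall L (x : cell L _), run (M ⊙ N) ∘
  ((id2 (M ⊙ N) ⊙₂ epsK eps eps') ∘ (assoc (M ⊙ N) (Ns ⊙ Ms) (M ⊙ N) ∘ x))
  = epsw (epsK eps eps') (M ⊙ N) ∘ x.
  by move=> L x; rewrite /epsw !vcompA.
rewrite E /etaK 2!hcomp2_1id (vcompA (assoc _ _ _ ⊙₂ _)).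
rewrite (reassoc (epswK _ _ _)) (vcompA (epsw eps' _)) (vcompA (epsw _ _ ⊙₂ _)).
rewrite (vcompA (_ ⊙₂ id2 (M ⊙ N))) -(hcomp2_id M N).
rewrite -(reassoc2 (assoc_inv_nat _ _ _)).
rewrite -(reassoc2 (assoc_inv_nat _ _ _)) lun_inv_hcomp.
rewrite -[(eta ⊙₂ _ ⊙₂ _) ∘ _]hcomp2_1id (reassoc (eq_sym (hcomp2_1id _ _ _))).
rewrite epsw_nat hcomp2_1id (vcompA (etaw _ _ ⊙₂ _)).
rewrite -[(epsw _ _ ⊙₂ _) ∘ _]hcomp2_1id.
have -> : epsw eps M ∘ ((eta ⊙₂ id2 M) ∘ lun_inv M) = id2 M.
  by rewrite -[RHS]t /epsw !vcompA.
by rewrite hcomp2_id vcomp1r triangle1w.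
Qed.

Lemma triangle2_op (B : Bicategory) (A A' : B)
  (M : hom A A') (Ms : hom A' A)
  (eta : cell (unit1 A) (M ⊙ Ms)) (eps : cell (Ms ⊙ M) (unit1 A')) :
  @triangle1 (op B) A A' Ms M eta eps
  = (lun Ms ∘ (eps ⊙₂ id2 Ms) ∘ assoc_inv Ms M Ms
    ∘ (id2 Ms ⊙₂ eta) ∘ run_inv Ms = id2 Ms).
Proof. by []. Qed.

Lemma etaK_op (B : Bicategory) (A1 A2 A3 : B) (M : hom A1 A2)
  (N : hom A2 A3) (Ms : hom A2 A1) (Ns : hom A3 A2)
  (eta : cell (unit1 A1) (M ⊙ Ms)) (eta' : cell (unit1 A2) (N ⊙ Ns)) :
  @etaK (op B) A1 A2 A3 Ms Ns M N eta eta' = etaK eta eta'.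
Proof.
rewrite /etaK /etaw /= !hcomp2_id1 !hcomp2_1id -!vcompA; congr (_ ∘ _).
rewrite !vcompA -run_inv_triangle -(reassoc2 (assoc_nat _ _ _)) -!vcompA.
congr (_ ∘ _ ∘ _); rewrite vcompA.
apply: (iso_mono (assocK _ _ _)); rewrite (cancel_id (assocVK _ _ _)).
rewrite -vcompA pentagon !vcompA (hcomp2_Kid _ (assocVK _ _ _)).
by rewrite vcomp1r.
Qed.

Lemma epsK_op (B : Bicategory) (A1 A2 A3 : B) (M : hom A1 A2)
  (N : hom A2 A3) (Ms : hom A2 A1) (Ns : hom A3 A2)
  (eps : cell (Ms ⊙ M) (unit1 A2)) (eps' : cell (Ns ⊙ N) (unit1 A3)) :
  @epsK (op B) A1 A2 A3 Ms Ns M N eps eps' = epsK eps eps'.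
Proof.
rewrite /epsK /epsw /= !hcomp2_id1 !hcomp2_1id !vcompA -triangle !vcompA.
congr (_ ∘ (_ ∘ _)); rewrite (reassoc2 (assoc_nat _ _ _)); congr (_ ∘ _).
apply: (iso_mono (hcomp2_idK _ (assocK _ _ _))).
rewrite (cancel_id (hcomp2_idK _ (assocVK _ _ _))).
rewrite -!vcompA -pentagon !vcompA.
by rewrite assocVK vcomp1r.
Qed.

Lemma right_dualizable_hcomp (B : Bicategory) (A1 A2 A3 : B) (M : hom A1 A2)
  (N : hom A2 A3) :
  right_dualizable M -> right_dualizable N -> right_dualizable (M ⊙ N).
Proof.
move=> [Ms [eta [eps [t u]]]] [Ns [eta' [eps' [t' u']]]].
exists (Ns ⊙ Ms), (etaK eta eta'), (epsK eps eps'); split.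
  exact: triangle1K.
rewrite -triangle2_op -etaK_op -epsK_op.
by apply: (@triangle1K (op B) A1 A2 A3 Ms Ns M N).
Qed.

Lemma right_dualizable_unit1 (B : Bicategory) (A : B) :
  right_dualizable (unit1 A).
Proof.
exists (unit1 A), (lun_inv _), (lun _); split; rewrite !vcompA.
  rewrite (reassoc (triangle _ _)) -lun_unit.
  by rewrite (cancel_id (hcomp2_Kid _ (lunVK _))) lunVK.
rewrite {2}lun_unit (reassoc (triangle_inv _ _)).
by rewrite (cancel_id (hcomp2_idK _ (lunVK _))) lun_unit runVK.
Qed.

End Duals.

Section LambdaDef.
Variable B : Bicategory.

Lemma reassoc3 (X Y : B) (M N O P : hom X Y) (f : cell O P) (g : cell N O)
  (h : cell M N) (k : cell M P) :
  f ∘ (g ∘ h) = k -> forall L (x : cell L M), f ∘ (g ∘ (h ∘ x)) = k ∘ x.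
Proof. by move=> <- L x; rewrite !vcompA. Qed.

Lemma pent_a (X Y Z W V : B)
  (M : hom X Y) (N : hom Y Z) (P : hom Z W) (Q : hom W V) :
  (assoc_inv M N P ⊙₂ id2 Q) ∘ assoc_inv M (N ⊙ P) Q
  = assoc_inv (M ⊙ N) P Q ∘ (assoc_inv M N (P ⊙ Q) ∘ (id2 M ⊙₂ assoc N P Q)).
Proof.
rewrite -vcompA pentagon_inv !vcompA.
by rewrite (hcomp2_idK _ (assocK _ _ _)) vcomp1r.
Qed.

Lemma pent_d (X Y Z W V : B)
  (M : hom X Y) (N : hom Y Z) (P : hom Z W) (Q : hom W V) :
  (assoc M N P ⊙₂ id2 Q)
    ∘ (assoc_inv (M ⊙ N) P Q ∘ assoc_inv M N (P ⊙ Q))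
  = assoc_inv M (N ⊙ P) Q ∘ (id2 M ⊙₂ assoc_inv N P Q).
Proof.
by rewrite pentagon_inv (cancel_id (hcomp2_Kid _ (assocVK _ _ _))).
Qed.

Lemma pent_b (X Y Z W V : B)
  (M : hom X Y) (N : hom Y Z) (P : hom Z W) (Q : hom W V) :
  (assoc M N P ⊙₂ id2 Q) ∘ assoc_inv (M ⊙ N) P Q
  = assoc_inv M (N ⊙ P) Q ∘ ((id2 M ⊙₂ assoc_inv N P Q) ∘ assoc M N (P ⊙ Q)).
Proof.
by rewrite -[RHS]vcompA -pent_d !vcompA assocK vcomp1r.
Qed.

Lemma pent_c (X Y Z W V : B)
  (M : hom X Y) (N : hom Y Z) (P : hom Z W) (Q : hom W V) :
  assoc (M ⊙ N) P Q
    ∘ ((assoc_inv M N P ⊙₂ id2 Q) ∘ assoc_inv M (N ⊙ P) Q)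
  = assoc_inv M N (P ⊙ Q) ∘ (id2 M ⊙₂ assoc N P Q).
Proof. by rewrite pent_a (cancel_id (assocVK _ _ _)). Qed.

Record Lob := { base : B; endo : hom base base }.

(** Dualizability is a property: no choice of dual is part of the 1-cell. *)
Record Lhom (P Q : Lob) := {
  carrier : hom (base P) (base Q);
  carrier_dual : right_dualizable carrier;
  twist : cell (endo P ⊙ carrier) (carrier ⊙ endo Q)
}.

Definition is_Lcell (P Q : Lob) (m n : Lhom P Q)
  (b : cell (carrier m) (carrier n)) : Prop :=
  is_iso b /\
  twist n ∘ (id2 (endo P) ⊙₂ b) = (b ⊙₂ id2 (endo Q)) ∘ twist m.

Definition Lcell (P Q : Lob) (m n : Lhom P Q) :=
  {b : cell (carrier m) (carrier n) | is_Lcell b}.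

Definition Lunit (P : Lob) : Lhom P P := {|
  carrier := unit1 (base P);
  carrier_dual := right_dualizable_unit1 (base P);
  twist := lun_inv (endo P) ∘ run (endo P)
|}.

Definition Lhcomp (P Q T : Lob) (m : Lhom P Q) (n : Lhom Q T) : Lhom P T := {|
  carrier := carrier m ⊙ carrier n;
  carrier_dual :=
    right_dualizable_hcomp (carrier_dual m) (carrier_dual n);
  twist :=
    assoc_inv (carrier m) (carrier n) (endo T)
    ∘ (id2 (carrier m) ⊙₂ twist n)
    ∘ assoc (carrier m) (endo Q) (carrier n)
    ∘ (twist m ⊙₂ id2 (carrier n))
    ∘ assoc_inv (endo P) (carrier m) (carrier n)
|}.

Lemma Lcell_eq (P Q : Lob) (m n : Lhom P Q) (b c : Lcell m n) :
  proj1_sig b = proj1_sig c -> b = c.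
Proof.
case: b c => [b pb] [c pc] /= e; move: pc; rewrite -e => pc.
by rewrite (proof_irrelevance _ pb pc).
Qed.

Lemma is_Lcell_id (P Q : Lob) (m : Lhom P Q) :
  is_Lcell (m := m) (n := m) (id2 (carrier m)).
Proof.
split; first by exists (id2 _); rewrite vcomp1l.
by rewrite !hcomp2_id vcomp1l vcomp1r.
Qed.

Lemma is_Lcell_vcomp (P Q : Lob) (m n p : Lhom P Q)
  (c : cell (carrier n) (carrier p)) (b : cell (carrier m) (carrier n)) :
  is_Lcell c -> is_Lcell b -> is_Lcell (c ∘ b).
Proof.
move=> [[c' [k1 k2]] ec] [[b' [k3 k4]] eb]; split.
  exists (b' ∘ c'); split; rewrite vcompA.
    by rewrite (cancel_id k1).
  by rewrite (cancel_id k4).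
by rewrite hcomp2_id1 hcomp2_1id -vcompA ec vcompA eb vcompA.
Qed.

Lemma is_Lcell_inv (P Q : Lob) (m n : Lhom P Q)
  (b : cell (carrier m) (carrier n)) (c : cell (carrier n) (carrier m)) :
  is_Lcell b -> c ∘ b = id2 _ -> b ∘ c = id2 _ -> is_Lcell c.
Proof.
move=> [_ e] cb bc; split; first by exists b.
by apply: (conj_inv (hcomp2_idK _ bc) (hcomp2_Kid _ cb)); rewrite e.
Qed.

Lemma is_Lcell_hcomp2 (P Q T : Lob) (m m' : Lhom P Q) (n n' : Lhom Q T)
  (b : cell (carrier m) (carrier m')) (c : cell (carrier n) (carrier n')) :
  is_Lcell b -> is_Lcell c ->
  is_Lcell (m := Lhcomp m n) (n := Lhcomp m' n') (b ⊙₂ c).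
Proof.
move=> [[b' [k1 k2]] eb] [[c' [k3 k4]] ec]; split.
  exists (b' ⊙₂ c'); rewrite -!hcomp2_vcomp k1 k2 k3 k4 !hcomp2_id.
  by split.
have e1 : (twist m' ⊙₂ id2 _) ∘ ((id2 _ ⊙₂ b) ⊙₂ c)
        = ((b ⊙₂ id2 _) ⊙₂ c) ∘ (twist m ⊙₂ id2 _).
  by rewrite -!hcomp2_vcomp eb vcomp1l vcomp1r.
have e2 : (id2 _ ⊙₂ twist n') ∘ (b ⊙₂ (id2 _ ⊙₂ c))
        = (b ⊙₂ (c ⊙₂ id2 _)) ∘ (id2 _ ⊙₂ twist n).
  by rewrite -!hcomp2_vcomp ec vcomp1l vcomp1r.
rewrite /= !vcompA -assoc_inv_nat (reassoc2 e1) (reassoc2 (assoc_nat _ _ _)).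
by rewrite (reassoc2 e2) -(reassoc2 (assoc_inv_nat _ _ _)).
Qed.

Lemma is_Lcell_lun (P Q : Lob) (m : Lhom P Q) :
  is_Lcell (m := Lhcomp (Lunit P) m) (n := m) (lun (carrier m)).
Proof.
split; first by exists (lun_inv _); rewrite lunK lunVK.
rewrite /= !vcompA -lun_hcomp !vcompA (cancel_id (assocVK _ _ _)).
rewrite (reassoc2 (lun_nat _)); congr (_ ∘ _).
rewrite (reassoc (lun_hcomp _ _)) hcomp2_1id !vcompA.
by rewrite (cancel_id (hcomp2_Kid _ (lunVK _))) triangle_inv.
Qed.

Lemma is_Lcell_run (P Q : Lob) (m : Lhom P Q) :
  is_Lcell (m := Lhcomp m (Lunit Q)) (n := m) (run (carrier m)).
Proof.
split; first by exists (run_inv _); rewrite runK runVK.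
rewrite /= !vcompA (reassoc (triangle_inv _ _)) hcomp2_id1.
rewrite !vcompA (cancel_id (hcomp2_idK _ (lunVK _))) -(run_hcomp _ (endo Q)) !vcompA.
rewrite (cancel_id (assocK _ _ _)) (reassoc2 (run_nat _)); congr (_ ∘ _).
by rewrite run_hcomp.
Qed.

Lemma is_Lcell_assoc (P Q S T : Lob) (m : Lhom P Q) (n : Lhom Q S)
  (p : Lhom S T) :
  is_Lcell (m := Lhcomp (Lhcomp m n) p) (n := Lhcomp m (Lhcomp n p))
    (assoc (carrier m) (carrier n) (carrier p)).
Proof.
split; first by exists (assoc_inv _ _ _); rewrite assocK assocVK.
rewrite /= !hcomp2_id1 !hcomp2_1id !vcompA pent_a.
rewrite (reassoc2 (assoc_inv_nat _ _ _)) hcomp2_id (reassoc (pent_b _ (endo Q) _ _)).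
rewrite !vcompA (reassoc2 (assoc_inv_nat _ _ _)).
rewrite (reassoc3 (pent_c _ _ _ _)) -(hcomp2_id (carrier m) (carrier n)).
rewrite !vcompA (reassoc2 (assoc_inv_nat _ _ _)).
by rewrite (reassoc3 (pent_d _ _ _ _)) !vcompA.
Qed.

Definition Lambda : Bicategory.
Proof.
refine {|
  ob := Lob;
  hom := Lhom;
  cell := Lcell;
  id2 := fun P Q m => exist _ (id2 (carrier m)) (is_Lcell_id m);
  vcomp := fun P Q m n p c b =>
    exist _ (proj1_sig c ∘ proj1_sig b)
      (is_Lcell_vcomp (proj2_sig c) (proj2_sig b));
  unit1 := Lunit;
  hcomp := Lhcomp;
  hcomp2 := fun P Q T m m' n n' b c =>
    exist _ (proj1_sig b ⊙₂ proj1_sig c)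
      (is_Lcell_hcomp2 (proj2_sig b) (proj2_sig c));
  assoc := fun P Q S T m n p =>
    exist _ (assoc (carrier m) (carrier n) (carrier p)) (is_Lcell_assoc m n p);
  assoc_inv := fun P Q S T m n p =>
    exist _ (assoc_inv (carrier m) (carrier n) (carrier p))
      (is_Lcell_inv (is_Lcell_assoc m n p) (assocK _ _ _) (assocVK _ _ _));
  lun := fun P Q m => exist _ (lun (carrier m)) (is_Lcell_lun m);
  lun_inv := fun P Q m =>
    exist _ (lun_inv (carrier m))
      (is_Lcell_inv (is_Lcell_lun m) (lunK _) (lunVK _));
  run := fun P Q m => exist _ (run (carrier m)) (is_Lcell_run m);
  run_inv := fun P Q m =>
    exist _ (run_inv (carrier m))
      (is_Lcell_inv (is_Lcell_run m) (runK _) (runVK _))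
|}; intros; apply: Lcell_eq => /=.
- exact: vcompA.
- exact: vcomp1l.
- exact: vcomp1r.
- exact: hcomp2_id.
- exact: hcomp2_vcomp.
- exact: assoc_nat.
- exact: lun_nat.
- exact: run_nat.
- exact: assocK.
- exact: assocVK.
- exact: lunK.
- exact: lunVK.
- exact: runK.
- exact: runVK.
- exact: pentagon.
- exact: triangle.
Defined.

End LambdaDef.

(** Strong 2-functors (pseudofunctors).  [fphi] and [fiota] are the structure
    isomorphisms [F M ⊙ F N => F (M ⊙ N)] and [U_{F A} => F U_A]. *)

Record PsFunctorData (B C : Bicategory) := {
  fob :> B -> C;
  fhom : forall A A' : B, hom A A' -> hom (fob A) (fob A');
  fcell : forall (A A' : B) (M N : hom A A'),
    cell M N -> cell (fhom M) (fhom N);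
  fphi : forall (A1 A2 A3 : B) (M : hom A1 A2) (N : hom A2 A3),
    cell (fhom M ⊙ fhom N) (fhom (M ⊙ N));
  fphi_inv : forall (A1 A2 A3 : B) (M : hom A1 A2) (N : hom A2 A3),
    cell (fhom (M ⊙ N)) (fhom M ⊙ fhom N);
  fiota : forall A : B, cell (unit1 (fob A)) (fhom (unit1 A));
  fiota_inv : forall A : B, cell (fhom (unit1 A)) (unit1 (fob A))
}.

Record is_psfunctor (B C : Bicategory) (F : PsFunctorData B C) : Prop := {
  fcell_id : forall (A A' : B) (M : hom A A'),
    fcell F (id2 M) = id2 (fhom F M);
  fcell_vcomp : forall (A A' : B) (M N P : hom A A')
    (g : cell N P) (f : cell M N),
    fcell F (g ∘ f) = fcell F g ∘ fcell F f;
  fphi_nat : forall (A1 A2 A3 : B) (M M' : hom A1 A2) (N N' : hom A2 A3)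
    (a : cell M M') (b : cell N N'),
    fphi F M' N' ∘ (fcell F a ⊙₂ fcell F b) = fcell F (a ⊙₂ b) ∘ fphi F M N;
  fphiK : forall (A1 A2 A3 : B) (M : hom A1 A2) (N : hom A2 A3),
    fphi_inv F M N ∘ fphi F M N = id2 _;
  fphiVK : forall (A1 A2 A3 : B) (M : hom A1 A2) (N : hom A2 A3),
    fphi F M N ∘ fphi_inv F M N = id2 _;
  fiotaK : forall A : B, fiota_inv F A ∘ fiota F A = id2 _;
  fiotaVK : forall A : B, fiota F A ∘ fiota_inv F A = id2 _;
  fphi_assoc : forall (A1 A2 A3 A4 : B)
    (M : hom A1 A2) (N : hom A2 A3) (P : hom A3 A4),
    fcell F (assoc M N P) ∘ fphi F (M ⊙ N) P ∘ (fphi F M N ⊙₂ id2 (fhom F P))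
    = fphi F M (N ⊙ P) ∘ (id2 (fhom F M) ⊙₂ fphi F N P)
      ∘ assoc (fhom F M) (fhom F N) (fhom F P);
  fphi_lun : forall (A A' : B) (M : hom A A'),
    fcell F (lun M) ∘ fphi F (unit1 A) M ∘ (fiota F A ⊙₂ id2 (fhom F M))
    = lun (fhom F M);
  fphi_run : forall (A A' : B) (M : hom A A'),
    fcell F (run M) ∘ fphi F M (unit1 A') ∘ (id2 (fhom F M) ⊙₂ fiota F A')
    = run (fhom F M)
}.

Record PsFunctor (B C : Bicategory) := {
  psdata :> PsFunctorData B C;
  pslaws : is_psfunctor psdata
}.

Definition pscomp_data (B C D : Bicategory)
  (G : PsFunctorData C D) (F : PsFunctorData B C) : PsFunctorData B D := {|
  fob := fun A => G (F A);
  fhom := fun A A' M => fhom G (fhom F M);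
  fcell := fun A A' M N f => fcell G (fcell F f);
  fphi := fun A1 A2 A3 M N =>
    fcell G (fphi F M N) ∘ fphi G (fhom F M) (fhom F N);
  fphi_inv := fun A1 A2 A3 M N =>
    fphi_inv G (fhom F M) (fhom F N) ∘ fcell G (fphi_inv F M N);
  fiota := fun A => fcell G (fiota F A) ∘ fiota G (F A);
  fiota_inv := fun A => fiota_inv G (F A) ∘ fcell G (fiota_inv F A)
|}.

Lemma fphi_natl (B C : Bicategory) (F : PsFunctorData B C) :
  is_psfunctor F -> forall (A1 A2 A3 : B) (M M' : hom A1 A2) (N : hom A2 A3)
    (a : cell M M'),
  fphi F M' N ∘ (fcell F a ⊙₂ id2 _) = fcell F (a ⊙₂ id2 _) ∘ fphi F M N.
Proof. by move=> f *; rewrite -(fcell_id f) (fphi_nat f). Qed.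

Lemma fphi_natr (B C : Bicategory) (F : PsFunctorData B C) :
  is_psfunctor F -> forall (A1 A2 A3 : B) (M : hom A1 A2) (N N' : hom A2 A3)
    (a : cell N N'),
  fphi F M N' ∘ (id2 _ ⊙₂ fcell F a) = fcell F (id2 _ ⊙₂ a) ∘ fphi F M N.
Proof. by move=> f *; rewrite -(fcell_id f) (fphi_nat f). Qed.

Lemma pscomp_laws (B C D : Bicategory) (G : PsFunctor C D)
  (F : PsFunctor B C) : is_psfunctor (pscomp_data G F).
Proof.
case: G F => [G g] [F f]; split=> /= *.
- by rewrite (fcell_id f) (fcell_id g).
- by rewrite (fcell_vcomp f) (fcell_vcomp g).
- rewrite vcompA (fphi_nat g) -!vcompA; congr (_ ∘ _).
  by rewrite -!(fcell_vcomp g) (fphi_nat f).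
- rewrite vcompA -[fcell G (fphi_inv F _ _) ∘ _]vcompA -(fcell_vcomp g).
  by rewrite (fphiK f) (fcell_id g) vcomp1l (fphiK g).
- rewrite vcompA (cancel_id (fphiVK g _ _)) -(fcell_vcomp g).
  by rewrite (fphiVK f) (fcell_id g).
- rewrite vcompA -[fcell G (fiota_inv F _) ∘ _]vcompA -(fcell_vcomp g).
  by rewrite (fiotaK f) (fcell_id g) vcomp1l (fiotaK g).
- rewrite vcompA (cancel_id (fiotaVK g _)) -(fcell_vcomp g).
  by rewrite (fiotaVK f) (fcell_id g).
- rewrite hcomp2_1id hcomp2_id1 !vcompA.
  rewrite (reassoc2 (fphi_natl g _ _)) (reassoc2 (fphi_natr g _ _)).
  rewrite -(vcompA _ _ (assoc _ _ _)) -(fphi_assoc g) !vcompA.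
  rewrite -!(vcompA (fcell G _)) -!(fcell_vcomp g) -!(vcompA (fcell G _)).
  by rewrite -!(fcell_vcomp g) -(fphi_assoc f).
- rewrite hcomp2_1id !vcompA (reassoc2 (fphi_natl g _ _)).
  rewrite -!vcompA -!(fcell_vcomp g) (fphi_lun f).
  by rewrite (fphi_lun g).
- rewrite hcomp2_id1 !vcompA (reassoc2 (fphi_natr g _ _)).
  rewrite -!vcompA -!(fcell_vcomp g) (fphi_run f).
  by rewrite (fphi_run g).
Qed.

Definition pscomp (B C D : Bicategory) (G : PsFunctor C D)
  (F : PsFunctor B C) : PsFunctor B D :=
  {| psdata := pscomp_data G F; pslaws := pscomp_laws G F |}.

Section LambdaFunctor.
Variables (B C : Bicategory) (F : PsFunctorData B C).

Definition LF_ob (P : Lob B) : Lob C :=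
  {| base := F (base P); endo := fhom F (endo P) |}.

Definition LF_twist (P Q : Lob B) (m : Lhom P Q) :
  cell (fhom F (endo P) ⊙ fhom F (carrier m))
       (fhom F (carrier m) ⊙ fhom F (endo Q)) :=
  fphi_inv F (carrier m) (endo Q) ∘ fcell F (twist m)
    ∘ fphi F (endo P) (carrier m).

Definition LF_hom
  (hd : forall (A A' : B) (M : hom A A'),
    right_dualizable M -> right_dualizable (fhom F M))
  (P Q : Lob B) (m : Lhom P Q) : Lhom (LF_ob P) (LF_ob Q) :=
  @Build_Lhom C (LF_ob P) (LF_ob Q)
    (fhom F (carrier m)) (hd _ _ _ (carrier_dual m)) (LF_twist m).

(** What has to hold for [LF_ob], [LF_hom] and [fcell F], together with the
    structure isomorphisms of [F], to land in the cells of [Lambda C]. *)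
Record Lambda_wd : Prop := {
  wd_dual : forall (A A' : B) (M : hom A A'),
    right_dualizable M -> right_dualizable (fhom F M);
  wd_cell : forall (P Q : Lob B) (m n : Lhom P Q)
    (b : cell (carrier m) (carrier n)), is_Lcell b ->
    is_Lcell (m := LF_hom wd_dual m) (n := LF_hom wd_dual n) (fcell F b);
  wd_phi : forall (P Q T : Lob B) (m : Lhom P Q) (n : Lhom Q T),
    is_Lcell (m := Lhcomp (LF_hom wd_dual m) (LF_hom wd_dual n))
      (n := LF_hom wd_dual (Lhcomp m n)) (fphi F (carrier m) (carrier n));
  wd_phi_inv : forall (P Q T : Lob B) (m : Lhom P Q) (n : Lhom Q T),
    is_Lcell (m := LF_hom wd_dual (Lhcomp m n))
      (n := Lhcomp (LF_hom wd_dual m) (LF_hom wd_dual n))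
      (fphi_inv F (carrier m) (carrier n));
  wd_iota : forall P : Lob B,
    is_Lcell (m := Lunit (LF_ob P)) (n := LF_hom wd_dual (Lunit P))
      (fiota F (base P));
  wd_iota_inv : forall P : Lob B,
    is_Lcell (m := LF_hom wd_dual (Lunit P)) (n := Lunit (LF_ob P))
      (fiota_inv F (base P))
}.

Definition LambdaF_data (w : Lambda_wd) :
  PsFunctorData (Lambda B) (Lambda C) :=
  @Build_PsFunctorData (Lambda B) (Lambda C)
    LF_ob
    (LF_hom (wd_dual w))
    (fun P Q m n b =>
       exist _ (fcell F (proj1_sig b)) (wd_cell w (proj2_sig b)))
    (fun P Q T m n => exist _ (fphi F (carrier m) (carrier n)) (wd_phi w m n))
    (fun P Q T m n =>
       exist _ (fphi_inv F (carrier m) (carrier n)) (wd_phi_inv w m n))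
    (fun P => exist _ (fiota F (base P)) (wd_iota w P))
    (fun P => exist _ (fiota_inv F (base P)) (wd_iota_inv w P)).

End LambdaFunctor.

(** [w] is unique by proof irrelevance, so this fixes all the data of [H]; its
    structure isomorphisms are those of [F]. *)
Definition is_LambdaF (B C : Bicategory) (F : PsFunctor B C)
  (H : PsFunctor (Lambda B) (Lambda C)) : Prop :=
  exists w : Lambda_wd F, psdata H = LambdaF_data w.

(* Main.v *)
(** All coherence cells of [F] intertwine those of [B] and [C], so after
    conjugating by [fphi] and [fiota] each condition (the triangle identities
    for [F M], the compatibility of [fphi] and [fiota] with the twists) is the
    [F]-image of the same condition in [B].  For the equality of composites,
    the two candidates agree up to the twists of the image 1-cells, and these
    agree because [G] preserves vertical composition. *)

From Corelib Require Import ssreflect.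
From Stdlib Require Import FunctionalExtensionality ProofIrrelevance.
Require Import Defs.

Set Implicit Arguments.
Unset Strict Implicit.
Unset Printing Implicit Defensive.

Local Open Scope bicat_scope.

Lemma reassoc33 (B : Bicategory) (X Y : B) (M N O N' O' P : hom X Y)
  (f : cell O P) (g : cell N O) (h : cell M N)
  (f' : cell O' P) (g' : cell N' O') (h' : cell M N') :
  f ∘ (g ∘ h) = f' ∘ (g' ∘ h') ->
  forall L (x : cell L M), f ∘ (g ∘ (h ∘ x)) = f' ∘ (g' ∘ (h' ∘ x)).
Proof. by move=> e L x; rewrite (reassoc3 e) !vcompA. Qed.

(** * Pseudofunctor axioms solved for inverse structure cells *)

Section PsFunctorLemmas.
Variables (B C : Bicategory) (F : PsFunctorData B C).
Hypothesis f : is_psfunctor F.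

Lemma fcell_inv (A A' : B) (M N : hom A A') (a : cell M N) (b : cell N M) :
  b ∘ a = id2 M -> fcell F b ∘ fcell F a = id2 _.
Proof. by move=> e; rewrite -(fcell_vcomp f) e (fcell_id f). Qed.

Lemma fphi_assocr (A1 A2 A3 A4 : B)
  (M : hom A1 A2) (N : hom A2 A3) (P : hom A3 A4) :
  fcell F (assoc M N P) ∘ (fphi F (M ⊙ N) P ∘ (fphi F M N ⊙₂ id2 _))
  = fphi F M (N ⊙ P) ∘ ((id2 _ ⊙₂ fphi F N P) ∘ assoc _ _ _).
Proof. by rewrite -!vcompA (fphi_assoc f). Qed.

Lemma fphi_assoc_inv (A1 A2 A3 A4 : B)
  (M : hom A1 A2) (N : hom A2 A3) (P : hom A3 A4) :
  fcell F (assoc_inv M N P) ∘ (fphi F M (N ⊙ P) ∘ (id2 _ ⊙₂ fphi F N P))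
  = fphi F (M ⊙ N) P ∘ ((fphi F M N ⊙₂ id2 _) ∘ assoc_inv _ _ _).
Proof.
apply: (iso_mono (fcell_inv (assocK M N P))).
rewrite (cancel_id (fcell_inv (assocVK M N P))).
by rewrite (reassoc33 (fphi_assocr _ _ _)) assocVK vcomp1r.
Qed.

(** In the first triangle identity for [fhom F M], the associator stands between the [fphi_inv] of
    the unit and the [fphi] of the counit. This form of the hexagon turns that block into a
    conjugate of an [F]-image; [fphi_assoc_inv_conj] does the same for the second identity. *)
Lemma fphi_assoc_conj (A1 A2 A3 A4 : B)
  (M : hom A1 A2) (N : hom A2 A3) (P : hom A3 A4) :
  (id2 _ ⊙₂ fphi F N P) ∘ (assoc _ _ _ ∘ (fphi_inv F M N ⊙₂ id2 _))
  = fphi_inv F M (N ⊙ P) ∘ (fcell F (assoc M N P) ∘ fphi F (M ⊙ N) P).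
Proof.
apply: (iso_mono (fphiK f _ _)); rewrite (cancel_id (fphiVK f _ _)).
rewrite -(reassoc33 (fphi_assocr _ _ _)).
by rewrite (hcomp2_Kid _ (fphiVK f _ _)) vcomp1r.
Qed.

Lemma fphi_assoc_inv_conj (A1 A2 A3 A4 : B)
  (M : hom A1 A2) (N : hom A2 A3) (P : hom A3 A4) :
  (fphi F M N ⊙₂ id2 _) ∘ (assoc_inv _ _ _ ∘ (id2 _ ⊙₂ fphi_inv F N P))
  = fphi_inv F (M ⊙ N) P ∘ (fcell F (assoc_inv M N P) ∘ fphi F M (N ⊙ P)).
Proof.
apply: (iso_mono (fphiK f _ _)); rewrite (cancel_id (fphiVK f _ _)).
rewrite -(reassoc33 (fphi_assoc_inv _ _ _)).
by rewrite (hcomp2_idK _ (fphiVK f _ _)) vcomp1r.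
Qed.

Lemma fcell_whiskerl (A1 A2 A3 : B) (M : hom A1 A2) (N N' : hom A2 A3)
  (a : cell N N') :
  id2 _ ⊙₂ fcell F a
  = fphi_inv F M N' ∘ (fcell F (id2 M ⊙₂ a) ∘ fphi F M N).
Proof. by rewrite -(fphi_natr f) (cancel_id (fphiK f _ _)). Qed.

Lemma fcell_whiskerr (A1 A2 A3 : B) (M M' : hom A1 A2) (N : hom A2 A3)
  (a : cell M M') :
  fcell F a ⊙₂ id2 _
  = fphi_inv F M' N ∘ (fcell F (a ⊙₂ id2 N) ∘ fphi F M N).
Proof. by rewrite -(fphi_natl f) (cancel_id (fphiK f _ _)). Qed.

(** Together with [fiota_lun_inv], this absorbs the two ends of the first triangle identity for
    [fhom F M]; [lun_fiota_inv] and [fiota_run_inv] absorb those of the second. *)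
Lemma run_fiota_inv (A A' : B) (M : hom A A') :
  run (fhom F M) ∘ (id2 _ ⊙₂ fiota_inv F A')
  = fcell F (run M) ∘ fphi F M (unit1 A').
Proof.
by rewrite -(fphi_run f) !vcompA (hcomp2_idK _ (fiotaVK f _)) vcomp1r.
Qed.

Lemma lun_fiota_inv (A A' : B) (M : hom A A') :
  lun (fhom F M) ∘ (fiota_inv F A ⊙₂ id2 _)
  = fcell F (lun M) ∘ fphi F (unit1 A) M.
Proof.
by rewrite -(fphi_lun f) !vcompA (hcomp2_Kid _ (fiotaVK f _)) vcomp1r.
Qed.

Lemma fiota_lun_inv (A A' : B) (M : hom A A') :
  (fiota F A ⊙₂ id2 _) ∘ lun_inv (fhom F M)
  = fphi_inv F (unit1 A) M ∘ fcell F (lun_inv M).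
Proof.
apply: (iso_mono (fphiK f _ _)); rewrite (cancel_id (fphiVK f _ _)).
apply: (iso_mono (fcell_inv (lunK M))); rewrite (fcell_inv (lunVK M)).
have := fphi_lun f M; rewrite !vcompA => e.
by rewrite (reassoc3 e) lunVK.
Qed.

Lemma fiota_run_inv (A A' : B) (M : hom A A') :
  (id2 _ ⊙₂ fiota F A') ∘ run_inv (fhom F M)
  = fphi_inv F M (unit1 A') ∘ fcell F (run_inv M).
Proof.
apply: (iso_mono (fphiK f _ _)); rewrite (cancel_id (fphiVK f _ _)).
apply: (iso_mono (fcell_inv (runK M))); rewrite (fcell_inv (runVK M)).
have := fphi_run f M; rewrite !vcompA => e.
by rewrite (reassoc3 e) runVK.
Qed.

Lemma right_dualizable_fhom (A A' : B) (M : hom A A') :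
  right_dualizable M -> right_dualizable (fhom F M).
Proof.
move=> [Ms [eta [eps [t u]]]].
exists (fhom F Ms), (fphi_inv F M Ms ∘ (fcell F eta ∘ fiota F A)),
  (fiota_inv F A' ∘ (fcell F eps ∘ fphi F Ms M)).
split; rewrite !hcomp2_id1 !hcomp2_1id !vcompA.
- rewrite (reassoc (run_fiota_inv _)) fiota_lun_inv.
  rewrite (reassoc3 (fphi_assoc_conj _ _ _)).
  rewrite fcell_whiskerl fcell_whiskerr !vcompA.
  (* Each [fphi] now meets its inverse, which leaves the [F]-image of the composite in [t]. *)
  rewrite !(cancel_id (fphiVK f _ _)).
  by rewrite -!(fcell_vcomp f) -!vcompA t (fcell_id f).
- rewrite (reassoc (lun_fiota_inv _)) fiota_run_inv.
  rewrite (reassoc3 (fphi_assoc_inv_conj _ _ _)).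
  rewrite fcell_whiskerl fcell_whiskerr !vcompA.
  rewrite !(cancel_id (fphiVK f _ _)).
  by rewrite -!(fcell_vcomp f) -!vcompA u (fcell_id f).
Qed.

(** * Well-definedness and laws of the induced functor *)

Notation LFh := (LF_hom right_dualizable_fhom).

Lemma is_Lcell_fcell (P Q : Lob B) (m n : Lhom P Q)
  (b : cell (carrier m) (carrier n)) :
  is_Lcell b -> is_Lcell (m := LFh m) (n := LFh n) (fcell F b).
Proof.
move=> [[b' [k1 k2]] e]; split.
  by exists (fcell F b'); rewrite !fcell_inv.
rewrite /= /LF_twist fcell_whiskerl fcell_whiskerr !vcompA.
rewrite !(cancel_id (fphiVK f _ _)); congr (_ ∘ _).
by rewrite -!vcompA -!(fcell_vcomp f) e.
Qed.

(** The hexagon is applied once to each of the three associators in the twist of [Lhcomp]. In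
    between, naturality moves [fphi] past the whiskered twists and cancels the [fphi_inv] of each
    [LF_twist]. *)
Lemma is_Lcell_fphi (P Q T : Lob B) (m : Lhom P Q) (n : Lhom Q T) :
  is_Lcell (m := Lhcomp (LFh m) (LFh n)) (n := LFh (Lhcomp m n))
    (fphi F (carrier m) (carrier n)).
Proof.
split; first by exists (fphi_inv F _ _); rewrite (fphiK f) (fphiVK f).
rewrite /= /LF_twist !(fcell_vcomp f) !hcomp2_id1 !hcomp2_1id !vcompA.
apply: (iso_mono (fphiK f _ _)); rewrite (cancel_id (fphiVK f _ _)).
rewrite fphi_assoc_inv -(reassoc2 (fphi_natl f _ _)).
rewrite -(reassoc33 (fphi_assoc_inv _ _ _)).
rewrite (cancel_id (hcomp2_idK _ (fphiVK f _ _))).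
rewrite (reassoc2 (fphi_natr f _ _)).
rewrite -(reassoc33 (fphi_assocr _ _ _)).
by rewrite (cancel_id (hcomp2_Kid _ (fphiVK f _ _))).
Qed.

(** The twist of [Lunit] is [lun_inv] after [run], and each factor is handled by one unit axiom of
    [F]. *)
Lemma is_Lcell_fiota (P : Lob B) :
  is_Lcell (m := Lunit (LF_ob F P)) (n := LFh (Lunit P)) (fiota F (base P)).
Proof.
split; first by exists (fiota_inv F _); rewrite (fiotaK f) (fiotaVK f).
have := fphi_run f (endo P); rewrite !vcompA => e.
rewrite /= /LF_twist (fcell_vcomp f) !vcompA e.
by rewrite (reassoc (fiota_lun_inv _)) !vcompA.
Qed.

Lemma psfunctor_Lambda_wd : Lambda_wd F.
Proof.
exists right_dualizable_fhom.
- exact: is_Lcell_fcell.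
- exact: is_Lcell_fphi.
- move=> P Q T m n.
  by apply: (is_Lcell_inv (is_Lcell_fphi m n)); rewrite (fphiK f, fphiVK f).
- exact: is_Lcell_fiota.
- move=> P.
  by apply: (is_Lcell_inv (is_Lcell_fiota P)); rewrite (fiotaK f, fiotaVK f).
Qed.

(** Compositions and coherence cells of [Lambda] are those of the base on underlying 2-cells, so
    [Lcell_eq] reduces each law to the same law of [F]. *)
Lemma LambdaF_laws (w : Lambda_wd F) : is_psfunctor (LambdaF_data w).
Proof.
split=> *; apply: Lcell_eq => /=.
- exact: (fcell_id f).
- exact: (fcell_vcomp f).
- exact: (fphi_nat f).
- exact: (fphiK f).
- exact: (fphiVK f).
- exact: (fiotaK f).
- exact: (fiotaVK f).
- exact: (fphi_assoc f).
- exact: (fphi_lun f).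
- exact: (fphi_run f).
Qed.

End PsFunctorLemmas.

(** * Comparison of the two composites *)

Section TwistedData.
Variables (B C : Bicategory) (F : PsFunctorData B C).

Definition dual_family := forall (P Q : Lob B) (m : Lhom P Q),
  right_dualizable (fhom F (carrier m)).
Definition twist_family := forall (P Q : Lob B) (m : Lhom P Q),
  cell (fhom F (endo P) ⊙ fhom F (carrier m))
       (fhom F (carrier m) ⊙ fhom F (endo Q)).

Definition twisted_hom (hd : dual_family) (tw : twist_family)
  (P Q : Lob B) (m : Lhom P Q) : Lhom (LF_ob F P) (LF_ob F Q) :=
  @Build_Lhom C (LF_ob F P) (LF_ob F Q)
    (fhom F (carrier m)) (hd P Q m) (tw P Q m).

Record twisted_wd (hd : dual_family) (tw : twist_family) : Prop := {
  tw_cell : forall (P Q : Lob B) (m n : Lhom P Q) (b : Lcell m n),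
    is_Lcell (m := twisted_hom hd tw m) (n := twisted_hom hd tw n)
      (fcell F (proj1_sig b));
  tw_phi : forall (P Q T : Lob B) (m : Lhom P Q) (n : Lhom Q T),
    is_Lcell (m := Lhcomp (twisted_hom hd tw m) (twisted_hom hd tw n))
      (n := twisted_hom hd tw (Lhcomp m n)) (fphi F (carrier m) (carrier n));
  tw_phi_inv : forall (P Q T : Lob B) (m : Lhom P Q) (n : Lhom Q T),
    is_Lcell (m := twisted_hom hd tw (Lhcomp m n))
      (n := Lhcomp (twisted_hom hd tw m) (twisted_hom hd tw n))
      (fphi_inv F (carrier m) (carrier n));
  tw_iota : forall P : Lob B,
    is_Lcell (m := Lunit (LF_ob F P)) (n := twisted_hom hd tw (Lunit P))
      (fiota F (base P));
  tw_iota_inv : forall P : Lob B,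
    is_Lcell (m := twisted_hom hd tw (Lunit P)) (n := Lunit (LF_ob F P))
      (fiota_inv F (base P))
}.

(** [LambdaF_data] with the twists of the image 1-cells left as a parameter.
    Both [LambdaF_data] of a composite and the composite of two
    [LambdaF_data]s are convertible to instances of this, which reduces their
    equality to that of the twists and avoids transporting 2-cells along an
    equality of 1-cells. *)
Definition twisted_data (hd : dual_family) (tw : twist_family)
  (w : twisted_wd hd tw) : PsFunctorData (Lambda B) (Lambda C) :=
  @Build_PsFunctorData (Lambda B) (Lambda C)
    (LF_ob F)
    (twisted_hom hd tw)
    (fun P Q m n b => exist _ (fcell F (proj1_sig b)) (tw_cell w b))
    (fun P Q T m n => exist _ (fphi F (carrier m) (carrier n)) (tw_phi w m n))
    (fun P Q T m n =>
       exist _ (fphi_inv F (carrier m) (carrier n)) (tw_phi_inv w m n))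
    (fun P => exist _ (fiota F (base P)) (tw_iota w P))
    (fun P => exist _ (fiota_inv F (base P)) (tw_iota_inv w P)).

(** Apart from the twists, the two sides differ only in proofs: dualizability and the cell
    conditions are propositions. *)
Lemma twisted_data_eq (hd hd' : dual_family) (tw tw' : twist_family)
  (w : twisted_wd hd tw) (w' : twisted_wd hd' tw') :
  (forall P Q (m : Lhom P Q), tw P Q m = tw' P Q m) ->
  twisted_data w = twisted_data w'.
Proof.
move=> e.
have etw : tw = tw'.
  by do 3![apply: functional_extensionality_dep => ?]; apply: e.
rewrite -etw in w' *.
rewrite -(proof_irrelevance _ hd hd') in w' *.
by rewrite (proof_irrelevance _ w w').
Qed.

Definition LambdaF_twisted_wd (w : Lambda_wd F) :
  twisted_wd (fun P Q m => wd_dual w (carrier_dual m)) (LF_twist F) := {|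
  tw_cell := fun P Q m n b => wd_cell w (proj2_sig b);
  tw_phi := wd_phi w;
  tw_phi_inv := wd_phi_inv w;
  tw_iota := wd_iota w;
  tw_iota_inv := wd_iota_inv w
|}.

End TwistedData.

(** Conjugating by the composite's structure cell amounts to conjugating by [fphi F] under [G], then
    by [fphi G]. *)
Lemma LF_twist_comp (B C D : Bicategory) (F : PsFunctorData B C)
  (G : PsFunctor C D) (w : Lambda_wd F) (P Q : Lob B) (m : Lhom P Q) :
  LF_twist (pscomp_data G F) m = LF_twist G (LF_hom (wd_dual w) m).
Proof.
by rewrite /LF_twist /= /LF_twist !(fcell_vcomp (pslaws G)) !vcompA.
Qed.

(** The cell conditions are read off the composite functor so that
    [comp_LambdaF_data] holds by conversion, proofs included. *)
Definition comp_twisted_wd (B C D : Bicategory) (F : PsFunctorData B C)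
  (G : PsFunctorData C D) (w : Lambda_wd F) (v : Lambda_wd G) :=
  let H := pscomp_data (LambdaF_data v) (LambdaF_data w) in
  @Build_twisted_wd B D (pscomp_data G F)
    (fun P Q m => wd_dual v (wd_dual w (carrier_dual m)))
    (fun P Q m => LF_twist G (LF_hom (wd_dual w) m))
    (fun P Q m n b => proj2_sig (@fcell _ _ H P Q m n b))
    (fun P Q T m n => proj2_sig (@fphi _ _ H P Q T m n))
    (fun P Q T m n => proj2_sig (@fphi_inv _ _ H P Q T m n))
    (fun P => proj2_sig (@fiota _ _ H P))
    (fun P => proj2_sig (@fiota_inv _ _ H P)).

Lemma comp_LambdaF_data (B C D : Bicategory) (F : PsFunctorData B C)
  (G : PsFunctorData C D) (w : Lambda_wd F) (v : Lambda_wd G) :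
  pscomp_data (LambdaF_data v) (LambdaF_data w)
  = twisted_data (comp_twisted_wd w v).
Proof. by []. Qed.

Lemma PsFunctor_eq (B C : Bicategory) (F G : PsFunctor B C) :
  psdata F = psdata G -> F = G.
Proof.
case: F G => [F f] [G g] /= e; rewrite -e in g *.
by rewrite (proof_irrelevance _ f g).
Qed.

Theorem theorem4p3 (B C D : Bicategory) :
  (forall F : PsFunctor B C,
     exists LF : PsFunctor (Lambda B) (Lambda C), is_LambdaF F LF) /\
  (forall (F : PsFunctor B C) (G : PsFunctor C D)
     (LF : PsFunctor (Lambda B) (Lambda C))
     (LG : PsFunctor (Lambda C) (Lambda D))
     (LGF : PsFunctor (Lambda B) (Lambda D)),
     is_LambdaF F LF -> is_LambdaF G LG -> is_LambdaF (pscomp G F) LGF ->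
     LGF = pscomp LG LF).
Proof.
split=> [F | F G LF LG LGF [w eF] [v eG] [u eGF]].
  pose w := psfunctor_Lambda_wd (pslaws F).
  by exists {| psdata := LambdaF_data w; pslaws := LambdaF_laws (pslaws F) w |}, w.
apply: PsFunctor_eq; rewrite /= eF eG eGF.
rewrite comp_LambdaF_data.
(* [LambdaF_data u] is convertible to [twisted_data (LambdaF_twisted_wd u)]; naming the witness lets
   unification see this. *)
apply: (@twisted_data_eq _ _ _ _ _ _ _ (LambdaF_twisted_wd u)).
by move=> P Q m; apply: LF_twist_comp.
Qed.
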